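(* Every locally two-distance set in $\mathbb{R}^d$ with at least $\frac{d(d+1)}{2}+3$ points is a two-distance set. In particular, $LDS_d(2)\le\binom{d+2}{2}$.
   Context: A set $X\subset\mathbb{R}^d$ is a two-distance set if there are exactly two distinct Euclidean distances between distinct points of $X$; it is a locally two-distance set if for every $x\in X$ there are at most two distinct distances between $x$ and the other points of $X$. $LDS_d(2)$ denotes the largest cardinality of a locally two-distance set in $\mathbb{R}^d$. *)

(* Defs.v *)
From mathcomp Require Import all_boot all_order all_algebra.
From mathcomp Require Import boolp classical_sets functions cardinality reals.
Set Implicit Arguments.
Unset Strict Implicit.
Unset Printing Implicit Defensive.
Local Open Scope classical_set_scope.
Local Open Scope card_scope.
Local Open Scope ring_scope.

(* The norm that MathComp-Analysis puts on ['rV[R]_d] is the sup norm, hence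
   this explicit Euclidean distance. *)
Definition edist (R : realType) (d : nat) (x y : 'rV[R]_d) : R :=
  Num.sqrt (\sum_(i < d) (x ord0 i - y ord0 i) ^+ 2).

Definition distances (R : realType) (d : nat) (X : set 'rV[R]_d) : set R :=
  [set r | exists x y, [/\ X x, X y, x <> y & r = edist x y]].

Definition distances_from (R : realType) (d : nat) (X : set 'rV[R]_d)
    (x : 'rV[R]_d) : set R :=
  [set r | exists y, [/\ X y, y <> x & r = edist x y]].

Definition two_distance_set (R : realType) (d : nat) (X : set 'rV[R]_d) : Prop :=
  distances X #= `I_2.

Definition locally_two_distance_set (R : realType) (d : nat)
    (X : set 'rV[R]_d) : Prop :=
  forall x, X x -> distances_from X x #<= `I_2.

(* [is_LDS2 R d N] says that LDS_d(2) exists and equals N.  Infinite sets are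
   not excluded by definition: the second clause also bounds them. *)
Definition is_LDS2 (R : realType) (d N : nat) : Prop :=
  (exists X : set 'rV[R]_d, locally_two_distance_set X /\ X #= `I_N) /\
  (forall X : set 'rV[R]_d, locally_two_distance_set X -> X #<= `I_N).

(* Main.v *)
Require Import Defs.
From mathcomp Require Import all_boot all_order all_algebra.
From mathcomp Require Import boolp classical_sets functions cardinality reals.
From mathcomp Require Import ring zify.
Import Order.TTheory GRing.Theory Num.Theory.
Local Open Scope classical_set_scope.
Local Open Scope card_scope.

(** Let x_1, ..., x_n be a locally two-distance set, so that the squared
    distances D_ij from x_i take at most two values al_i, be_i > 0.

    Absolute bound.  Suppose n exceeds the number of monomials of degree at
    most 2 in d variables, which is 'C(d + 2, 2).  Then there are weights c_i,
    not all zero, that annihilate every polynomial of degree at most 2 on the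
    points.  Consider the sum over i, j of
    c_i c_j (D_ij - al_i) (D_ij - be_i).  Only its diagonal terms
    c_i ^ 2 al_i be_i survive.  On the other hand D_ij is
    |x_i|^2 + |x_j|^2 - 2 x_i . x_j, and in the expanded product each term of
    degree more than 2 in x_j has degree at most 1 in x_i and a coefficient
    free of al_i and be_i; hence every term is killed by the weights, either
    through j or through i.  So the c_i vanish, a contradiction
    ([moments_eq0]).  Working in the affine span, d may be replaced by its
    dimension m - 1, where m is the rank of the matrix with rows (x_i, 1); this
    gives n <= 'C(m + 1, 2) ([ldmx_bound]).  If the points lie on a sphere, its
    equation is a nontrivial linear relation between the monomials, and the
    bound drops by 1 ([spherical_ldmx_bound]).

    Splitting.  Suppose that the points are divided into parts A and B with at
    least two points each, every point of B being equidistant from all of A.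
    Then A is spherical, and the directions of A are orthogonal to those of B,
    so that the ranks satisfy m_A + m_B <= d + 2
    ([homog_rank_orthogonal]).  Adding the two bounds gives
    n <= d (d + 1) / 2 + 2 ([split_bound]).

    Hence a locally two-distance set with at least d (d + 1) / 2 + 3 points has
    no such splitting.  If a single distance occurred, any two points would
    form a part A.  If three or more occurred, let P(x) be the pair of
    distances allowed at x, and for a pair S let A_S be the set of the x with
    P(x) contained in S.  A point y outside A_S has at most one distance in
    common with S, so it is equidistant from all of A_S; the endpoints of an
    edge whose distance is not in S lie outside A_S, and there is such an
    edge; and some A_S has at least
    two elements, since otherwise the pairs P(x) would be distinct and pairwise
    intersecting, and from four points on they would have a single distance in
    common, which would be the only one to occur ([exists_split]).  So exactly
    two distances occur. *)

Set Implicit Arguments.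
Unset Strict Implicit.
Unset Printing Implicit Defensive.

Section PointMatrices.
Local Open Scope ring_scope.

(** * Weights annihilating the quadratic polynomials *)

(** Finite families of points are the rows of a matrix, which gives access to
    the rank. *)
Definition sqdist (R : realFieldType) n d (F : 'M[R]_(n, d)) i j :=
  \sum_k (F i k - F j k) ^+ 2.

(** The rank of this matrix is one more than the dimension of the affine span
    of the rows of [F]. *)
Definition homog (R : realFieldType) n d (F : 'M[R]_(n, d)) :
    'M[R]_(n, d + 1) :=
  row_mx F (const_mx 1).

(** An unattained [al i] or [be i] is an arbitrary positive value, so that the
    product of the two is always positive. *)
Definition locally_two_distance_mx (R : realFieldType) n d (F : 'M[R]_(n, d)) :=
  exists al be : 'I_n -> R, [/\ forall i, 0 < al i, forall i, 0 < be i &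
    forall i j, j != i -> sqdist F i j = al i \/ sqdist F i j = be i].

Lemma sqdist_dot (R : realFieldType) n d (F : 'M[R]_(n, d)) i j :
  sqdist F i j = (F *m F^T) i i + (F *m F^T) j j - (F *m F^T) i j *+ 2.
Proof.
rewrite /sqdist !mxE -sumrMnl -big_split -sumrB /=; apply: eq_bigr => k _.
by rewrite !mxE; ring.
Qed.

Lemma moment_dot (R : realFieldType) n d (F : 'M[R]_(n, d)) (c : 'I_n -> R) i :
  (forall k, \sum_j c j * F j k = 0) -> \sum_j c j * (F *m F^T) i j = 0.
Proof.
move=> h1; under eq_bigr do rewrite mxE mulr_sumr.
rewrite exchange_big big1 //= => k _.
under eq_bigr do rewrite mxE mulrCA.
by rewrite -mulr_sumr h1 mulr0.
Qed.

Lemma moment_norm (R : realFieldType) n d (F : 'M[R]_(n, d)) (c : 'I_n -> R) :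
  (forall k l, \sum_j c j * (F j k * F j l) = 0) ->
  \sum_j c j * (F *m F^T) j j = 0.
Proof.
move=> h2; under eq_bigr do rewrite mxE mulr_sumr.
rewrite exchange_big big1 //= => k _.
by rewrite -[RHS](h2 k k); apply: eq_bigr => j _; rewrite mxE.
Qed.

Lemma moment_dot2 (R : realFieldType) n d (F : 'M[R]_(n, d)) (c : 'I_n -> R) i :
  (forall k l, \sum_j c j * (F j k * F j l) = 0) ->
  \sum_j c j * (F *m F^T) i j ^+ 2 = 0.
Proof.
move=> h2; under eq_bigr do rewrite mxE expr2 mulr_suml mulr_sumr.
rewrite exchange_big big1 //= => k _.
under eq_bigr do rewrite 2!mulr_sumr.
rewrite exchange_big big1 //= => l _.
transitivity (F i k * F i l * \sum_j c j * (F j k * F j l)); last first.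
  by rewrite h2 mulr0.
by rewrite mulr_sumr; apply: eq_bigr => j _; rewrite !mxE; ring.
Qed.

(** The two distances may depend on [i]: in row [i] of the double sum, all that
    [al i] and [be i] multiply has degree at most 2 in the point [j], and is
    therefore killed by the sum over [j] alone. *)
Lemma moments_eq0 (R : realFieldType) n d (F : 'M[R]_(n, d)) (c : 'I_n -> R) :
  locally_two_distance_mx F ->
  \sum_j c j = 0 -> (forall k, \sum_j c j * F j k = 0) ->
  (forall k l, \sum_j c j * (F j k * F j l) = 0) ->
  forall i, c i = 0.
Proof.
move=> [al [be [al0 be0 hF]]] h0 h1 h2.
pose G := F *m F^T.
have g1 i : \sum_j c j * G i j = 0 by apply: moment_dot.
have gn : \sum_j c j * G j j = 0 by apply: moment_norm.
have g2 i : \sum_j c j * G i j ^+ 2 = 0 by apply: moment_dot2.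
have Gsym i j : G i j = G j i.
  by rewrite !mxE; apply: eq_bigr => k _; rewrite !mxE mulrC.
pose D := sqdist F.
have key i : c i * (al i * be i) =
    \sum_j c j * G j j ^+ 2 - 4 * \sum_j (c j * G j j) * G i j.
  transitivity (\sum_j c j * ((D i j - al i) * (D i j - be i))).
    rewrite (bigD1 i) //= [X in _ = _ + X]big1 ?addr0.
      have -> : D i i = 0 by apply: big1 => k _; rewrite subrr expr0n.
      by rewrite !sub0r mulrNN.
    by move=> j ji; case: (hF i j ji); rewrite -/(D i j) => ->;
      rewrite subrr ?mul0r ?mulr0.
  transitivity (\sum_j (((c j * G j j ^+ 2 - 4 * ((c j * G j j) * G i j))
    + 4 * (c j * G i j ^+ 2))
    + (G i i ^+ 2 - (al i + be i) * G i i + al i * be i) * c j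
    + (2 * G i i - (al i + be i)) * (c j * G j j)
    + (2 * (al i + be i) - 4 * G i i) * (c j * G i j))).
    by apply: eq_bigr => j _; rewrite /D sqdist_dot -/G; ring.
  by rewrite !big_split /= -!mulr_sumr sumrN -mulr_sumr h0 g1 gn g2; ring.
have : \sum_i c i ^+ 2 * (al i * be i) = 0.
  transitivity (\sum_i c i * (c i * (al i * be i))).
    by apply: eq_bigr => i _; ring.
  under eq_bigr do rewrite key mulrBr mulrCA.
  rewrite sumrB -mulr_suml h0 mul0r sub0r -mulr_sumr.
  under eq_bigr do rewrite mulr_sumr.
  rewrite exchange_big big1 ?mulr0 ?oppr0 //= => j _.
  transitivity (c j * G j j * \sum_i c i * G j i); last by rewrite g1 mulr0.
  rewrite mulr_sumr; apply: eq_bigr => i _.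
  by rewrite (Gsym i j) mulrCA.
move/psumr_eq0P => /= H i.
have p0 k : 0 < al k * be k by exact: mulr_gt0.
have /eqP := H (fun k _ => mulr_ge0 (sqr_ge0 _) (ltW (p0 k))) i isT.
by rewrite mulf_eq0 sqrf_eq0 (gt_eqF (p0 i)) orbF => /eqP.
Qed.

(** * The absolute bound *)

Definition quad_index m := [set p : 'I_m * 'I_m | (p.1 <= p.2)%N]%SET.

Definition quad_mx (R : realFieldType) n m (C : 'M[R]_(n, m)) :
    'M[R]_(n, #|quad_index m|) :=
  \matrix_(i, k) (C i (enum_val k).1 * C i (enum_val k).2).

Lemma card_quad_index m : #|quad_index m| = 'C(m.+1, 2).
Proof.
rewrite -bin2_sum big_nat_recl // add0n big_mkord.
rewrite -sum1_card; under eq_bigl do rewrite inE.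
rewrite -(pair_big_dep predT (fun a b : 'I_m => (a <= b)%N)
                       (fun _ _ => 1%N)) /=.
rewrite (exchange_big_dep predT) //=; apply: eq_bigr => j _.
by rewrite -(big_ord_widen _ (fun=> 1%N) (ltn_ord j)) sum1_card card_ord.
Qed.

Lemma quad_mx_kernel (R : realFieldType) n m (C : 'M[R]_(n, m)) (c : 'rV_n) :
  c *m quad_mx C = 0 -> forall a b, \sum_j c 0 j * (C j a * C j b) = 0.
Proof.
move=> hc a b; wlog ab : a b / (a <= b)%N => [W|].
  have [/W //|/ltnW /W h] := leqP a b.
  by rewrite -[RHS]h; apply: eq_bigr => j _; rewrite (mulrC (C j a)).
have iab : (a, b) \in quad_index m by rewrite inE.
have /rowP /(_ (enum_rank_in iab (a, b))) := hc; rewrite !mxE => h.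
by rewrite -[RHS]h; apply: eq_bigr => j _; rewrite mxE enum_rankK_in.
Qed.

(** The columns of [col_base (homog F)] are coordinates on the affine span;
    since the constant 1 is a combination of them, their products of degree
    exactly 2 span all polynomials of degree at most 2 on the points. *)
Lemma quad_mx_free (R : realFieldType) n d (F : 'M[R]_(n, d)) :
  locally_two_distance_mx F -> row_free (quad_mx (col_base (homog F))).
Proof.
move=> hF; apply: inj_row_free => c /quad_mx_kernel hc.
have hU k l : \sum_j c 0 j * (homog F j k * homog F j l) = 0.
  rewrite -(mulmx_base (homog F)).
  under eq_bigr do rewrite !mxE mulr_suml mulr_sumr.
  rewrite exchange_big big1 //= => a _.
  under eq_bigr do rewrite 2!mulr_sumr.
  rewrite exchange_big big1 //= => b _.
  set V := row_base _.
  transitivity (V a k * V b l * (\sum_j c 0 j *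
    (col_base (homog F) j a * col_base (homog F) j b))).
    by rewrite mulr_sumr; apply: eq_bigr => j _; ring.
  by rewrite hc mulr0.
have U1 j : homog F j (rshift d 0) = 1 by rewrite row_mxEr mxE.
have UF j k : homog F j (lshift 1 k) = F j k by rewrite row_mxEl.
have c0 : forall i, c 0 i = 0.
  apply: (moments_eq0 hF).
  - rewrite -[RHS](hU (rshift d 0) (rshift d 0)).
    by apply: eq_bigr => j _; rewrite !U1 !mulr1.
  - move=> k; rewrite -[RHS](hU (lshift 1 k) (rshift d 0)).
    by apply: eq_bigr => j _; rewrite U1 UF mulr1.
  - move=> k l; rewrite -[RHS](hU (lshift 1 k) (lshift 1 l)).
    by apply: eq_bigr => j _; rewrite !UF.
by apply/rowP => i; rewrite c0 mxE.
Qed.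

Lemma ldmx_bound (R : realFieldType) n d (F : 'M[R]_(n, d)) :
  locally_two_distance_mx F -> (n <= 'C((\rank (homog F)).+1, 2))%N.
Proof.
move=> /quad_mx_free /eqP {1}<-; rewrite -card_quad_index.
exact: rank_leq_col.
Qed.

(** * The bound on a sphere *)

(** The two symmetric off-diagonal coefficients of the form are gathered in the
    monomial with ordered indices. *)
Lemma quad_coefP (R : realFieldType) m (Q : 'M[R]_m) :
  exists v : 'cV[R]_#|quad_index m|, forall z : 'rV_m, (z *m Q *m z^T) 0 0 =
    \sum_k (z 0 (enum_val k).1 * z 0 (enum_val k).2) * v k 0.
Proof.
exists (\col_k let: (a, b) := enum_val k in Q a b + (Q b a) *+ (a < b)%N) => z.
under eq_bigr do rewrite mxE.
pose f (p : 'I_m * 'I_m) := (z 0 p.1 * z 0 p.2) *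
  (let: (a, b) := p in Q a b + (Q b a) *+ (a < b)%N).
rewrite -(big_enum_val f) /=.
pose g (p : 'I_m * 'I_m) := z 0 p.1 * Q p.1 p.2 * z 0 p.2.
transitivity (\sum_p g p).
  rewrite -(pair_bigA _ (fun a b => g (a, b))) exchange_big mxE.
  apply: eq_bigr => b _; rewrite mxE mulr_suml.
  by apply: eq_bigr => a _; rewrite mxE.
rewrite (bigID (mem (quad_index m))) /=.
have -> : \sum_(p | p \notin quad_index m) g p =
    \sum_(p in quad_index m) (g (p.2, p.1)) *+ (p.1 < p.2)%N.
  rewrite (reindex_inj (h := fun p => (p.2, p.1))) /=; last first.
    by move=> [? ?] [? ?] [-> ->].
  rewrite big_mkcond [RHS]big_mkcond; apply: eq_bigr => -[a b] _ /=.
  by rewrite !inE /= -ltnNge; case: ltngtP.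
rewrite -big_split; apply: eq_bigr => -[a b] _.
by rewrite /f /g /=; case: (_ < _)%N; rewrite ?mulr1n ?mulr0n; ring.
Qed.

(** The homogenized equation of the sphere is a quadratic form vanishing on all
    rows of [homog F], hence a relation between the columns of [quad_mx].  The
    relation is nontrivial because the form takes at the difference of two rows
    the value of their squared distance. *)
Lemma spherical_ldmx_bound (R : realFieldType) n d (F : 'M[R]_(n, d))
    (o : 'rV_d) rho :
  locally_two_distance_mx F -> (1 < n)%N ->
  (forall i, \sum_k (F i k - o 0 k) ^+ 2 = rho) ->
  (n < 'C((\rank (homog F)).+1, 2))%N.
Proof.
move=> hF n1 sph.
pose C := col_base (homog F); pose V := row_base (homog F).
have CV : C *m V = homog F by apply: mulmx_base.
pose S : 'M[R]_(d + 1, d) := col_mx 1%:M (- o).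
pose T : 'M[R]_(d + 1, 1) := col_mx 0 1%:M.
(* [S] and [T] send (x, t) to x - t o and to t, so that [Q] is the form
   |x - t o|^2 - rho t^2. *)
pose Q := S *m S^T - rho *: (T *m T^T).
have QE (u : 'rV_(d + 1)) : (u *m Q *m u^T) 0 0 =
    \sum_k ((u *m S) 0 k) ^+ 2 - rho * ((u *m T) 0 0) ^+ 2.
  rewrite /Q mulmxBr mulmxBl -scalemxAr -scalemxAl !mulmxA.
  rewrite -[_ *m S^T *m _]mulmxA -trmx_mul -[_ *m T^T *m _]mulmxA -trmx_mul.
  rewrite [LHS]mxE [X in _ + X]mxE [X in _ - X]mxE.
  rewrite [X in X - _]mxE [X in _ - rho * X]mxE big_ord1.
  rewrite [((u *m T)^T) _ _]mxE.
  by congr (_ - _); apply: eq_bigr => k _; rewrite [(_^T) _ _]mxE.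
have [v hv] := quad_coefP (V *m Q *m V^T).
have hvU (z : 'rV_(\rank (homog F))) : (z *m V *m Q *m (z *m V)^T) 0 0 =
    \sum_k (z 0 (enum_val k).1 * z 0 (enum_val k).2) * v k 0.
  by rewrite -hv trmx_mul !mulmxA.
have one11 : const_mx 1 = 1%:M :> 'M[R]_1.
  by apply/matrixP => i j; rewrite !mxE !ord1.
have rowS i : row i (homog F) *m S = row i F - o.
  by rewrite row_row_mx mul_row_col mulmx1 row_const one11 mul1mx.
have rowT i : row i (homog F) *m T = 1%:M.
  by rewrite row_row_mx mul_row_col mulmx0 add0r mulmx1 row_const one11.
have v0 : quad_mx C *m v = 0.
  apply/matrixP => i j; rewrite [j]ord1 mxE [RHS]mxE.
  transitivity ((row i C *m V *m Q *m (row i C *m V)^T) 0 0).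
    by rewrite hvU; apply: eq_bigr => k _; rewrite !mxE.
  rewrite -row_mul CV QE rowT rowS mxE eqxx expr1n mulr1 -(sph i).
  by apply/eqP; rewrite subr_eq0; apply/eqP/eq_bigr => k _; rewrite !mxE.
have vN0 : v != 0.
  pose i0 := Ordinal (ltnW n1); pose i1 := Ordinal n1.
  apply/eqP => vz.
  have := hvU (row i0 C - row i1 C); rewrite vz.
  rewrite big1 => [|k _]; last by rewrite [X in _ * X]mxE mulr0.
  rewrite mulmxBl -!row_mul CV QE !mulmxBl !rowT !rowS.
  move=> H.
  have [al [be [al0 be0 hd]]] := hF.
  have : 0 < sqdist F i0 i1 by case: (hd i0 i1 isT) => ->.
  rewrite (_ : sqdist F i0 i1 = 0) ?ltxx // -[RHS]H.
  rewrite subrr [X in _ * X ^+ 2]mxE expr0n mulr0 subr0.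
  by apply: eq_bigr => k _; rewrite !mxE; congr (_ ^+ 2); ring.
have := mulmx0_rank_max v0.
rewrite (eqP (quad_mx_free hF)) -card_quad_index.
apply: leq_trans; rewrite -addn1 leq_add2l lt0n.
by rewrite mxrank_eq0.
Qed.

(** * Splitting into two equidistant parts *)

(** The orthogonality of the two affine spans is expressed by lifting to
    dimension d + 2: if |a - b|^2 = |x - b|^2, then the vectors
    (a, 1, |a|^2) and (2 b, - k(b), -1), with k(b) = 2 x . b - |x|^2, are
    orthogonal. *)
Lemma homog_rank_orthogonal (R : realFieldType) n1 n2 d
    (A : 'M[R]_(n1, d)) (B : 'M[R]_(n2, d)) (x : 'rV_d) :
  (forall i j, \sum_k (A i k - B j k) ^+ 2 = \sum_k (x 0 k - B j k) ^+ 2) ->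
  (\rank (homog A) + \rank (homog B) <= d + 2)%N.
Proof.
move=> eqd.
pose nA : 'cV[R]_n1 := \col_i \sum_k A i k ^+ 2.
pose kB : 'cV[R]_n2 := \col_j \sum_k (x 0 k * B j k *+ 2 - x 0 k ^+ 2).
pose LA : 'M_(n1, d + 1 + 1) := row_mx (homog A) nA.
pose LB : 'M_(n2, d + 1 + 1) :=
  row_mx (row_mx (2 *: B) (- kB)) (const_mx (- 1)).
have LAB : LA *m LB^T = 0.
  rewrite !tr_row_mx !mul_row_col.
  apply/matrixP => i j; rewrite mxE [X in X + _]mxE [in RHS]mxE.
  rewrite [X in _ + X]mxE big_ord1 [X in _ + X + _]mxE big_ord1 !mxE.
  transitivity (\sum_k ((x 0 k - B j k) ^+ 2 - (A i k - B j k) ^+ 2)).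
    rewrite mul1r mulrN1 -!sumrN -!big_split /=.
    by apply: eq_bigr => k _; rewrite !mxE; ring.
  by rewrite sumrB eqd subrr.
have LAr : homog A = LA *m col_mx 1%:M 0.
  by rewrite mul_row_col mulmx1 mulmx0 addr0.
have LBr : homog B = LB *m col_mx (col_mx (row_mx (2^-1)%:M 0) 0)
                                  (row_mx 0 (- 1)%:M).
  rewrite !mul_row_col mulmx0 addr0 !mul_mx_row !mulmx0 add_row_mx addr0 add0r.
  rewrite !mul_mx_scalar scalerA mulVf ?pnatr_eq0 // scale1r.
  by congr row_mx; apply/matrixP => i j; rewrite !mxE mulrNN mulr1.
have -> : (d + 2 = d + 1 + 1)%N by rewrite -addnA.
apply: leq_trans (mulmx0_rank_max LAB); rewrite mxrank_tr.
by rewrite leq_add // 1?LAr 1?LBr mxrankM_maxl.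
Qed.

Lemma ldmx_rowsub (R : realFieldType) n m d (F : 'M[R]_(n, d))
    (f : 'I_m -> 'I_n) :
  injective f -> locally_two_distance_mx F ->
  locally_two_distance_mx (rowsub f F).
Proof.
move=> f_inj [al [be [al0 be0 h]]]; exists (al \o f), (be \o f); split=> //=.
move=> i j ji; have fji : f j != f i by rewrite inj_eq.
by case: (h _ _ fji) => <-; [left | right]; apply: eq_bigr => k _; rewrite !mxE.
Qed.

Lemma double_bin2S k : ('C(k.+1, 2) * 2 = k.+1 * k)%N.
Proof. by rewrite bin2 muln2 /= -[RHS]odd_double_half oddM oddS andNb. Qed.

(** For a + b = d + 2 the right-hand side exceeds the sum of the bounds by
    (a - 2) (b - 2); the lower bounds on [p] and [q] force a, b >= 2. *)
Lemma binomial_sum_bound a b d p q :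
  (p < 'C(a.+1, 2))%N -> (q <= 'C(b.+1, 2))%N -> (a + b <= d + 2)%N ->
  (1 < p)%N -> (1 < q)%N -> (p + q <= (d * (d + 1)) %/ 2 + 2)%N.
Proof.
have -> : ((d * (d + 1)) %/ 2 = 'C(d.+1, 2))%N.
  by rewrite bin2 divn2 addn1 mulnC.
move: (double_bin2S a) (double_bin2S b) (double_bin2S d).
move: 'C(a.+1, 2) 'C(b.+1, 2) 'C(d.+1, 2) => u v w Ea Eb Ed pu qv abd p1 q1.
have a1 : (1 < a)%N by case: (a) Ea => [|[|?]]; lia.
have b1 : (1 < b)%N by case: (b) Eb => [|[|?]]; lia.
have [i ai] : exists i, a = i.+2 by exists a.-2; lia.
have [j bj] : exists j, b = j.+2 by exists b.-2; lia.
have [k dk] : exists k, d = (i + j + 2 + k)%N.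
  by exists (d - (i + j + 2))%N; lia.
subst a b d; nia.
Qed.

(** Any point of the complement is the centre of a sphere through [A]. *)
Lemma split_bound (R : realFieldType) n d (F : 'M[R]_(n, d)) (A : {set 'I_n}) :
  locally_two_distance_mx F -> (1 < #|A|)%N -> (1 < #|~: A|)%N ->
  (forall x x' y, x \in A -> x' \in A -> y \notin A ->
    sqdist F x y = sqdist F x' y) ->
  (n <= (d * (d + 1)) %/ 2 + 2)%N.
Proof.
move=> hF A1 B1 eqd.
pose fA : 'I_#|A| -> 'I_n := enum_val; pose fB : 'I_#|~: A| -> 'I_n := enum_val.
pose FA := rowsub fA F; pose FB := rowsub fB F.
have hA : locally_two_distance_mx FA.
  by apply: ldmx_rowsub hF; apply: enum_val_inj.
have hB : locally_two_distance_mx FB.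
  by apply: ldmx_rowsub hF; apply: enum_val_inj.
have eqAB i i' j : sqdist F (fA i) (fB j) = sqdist F (fA i') (fB j).
  apply: eqd; try exact: enum_valP.
  by have := enum_valP j; rewrite inE.
pose a0 : 'I_#|A| := Ordinal (ltnW A1).
pose b0 : 'I_#|~: A| := Ordinal (ltnW B1).
have bA : (#|A| < 'C((\rank (homog FA)).+1, 2))%N.
  apply: (@spherical_ldmx_bound _ _ _ FA (row (fB b0) F)
    (sqdist F (fA a0) (fB b0)) hA A1) => i.
  by rewrite -(eqAB i a0 b0); apply: eq_bigr => k _; rewrite !mxE.
have bB := ldmx_bound hB.
have rAB : (\rank (homog FA) + \rank (homog FB) <= d + 2)%N.
  apply: (@homog_rank_orthogonal _ _ _ _ _ _ (row (fA a0) F)) => i j.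
  transitivity (sqdist F (fA i) (fB j)).
    by apply: eq_bigr => k _; rewrite !mxE.
  by rewrite (eqAB i a0 j); apply: eq_bigr => k _; rewrite !mxE.
have cAB : (#|A| + #|~: A| = n)%N by rewrite cardsC card_ord.
by rewrite -[X in (X <= _)%N]cAB; apply: binomial_sum_bound bA bB rAB A1 B1.
Qed.

(** * Edge colourings with at most two colours at each vertex *)

(** The part consists of the vertices whose pair of colours lies in a suitable
    pair {s, t}.  Three vertices would not be enough for two of them to lie in
    the same part: the pairs {1, 2}, {1, 3}, {2, 3} intersect pairwise without
    having a common colour. *)
Lemma exists_split (T : finType) (K : eqType) (col : T -> T -> K)
    (a b : T -> K) :
  (forall x y, col x y = col y x) ->
  (forall x y, y != x -> col x y \in [:: a x; b x]) ->
  (3 < #|T|)%N ->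
  (forall s t, exists x y, y != x /\ col x y \notin [:: s; t]) ->
  exists A : {set T}, [/\ (1 < #|A|)%N, (1 < #|~: A|)%N &
    forall x x' y, x \in A -> x' \in A -> y \notin A -> col x y = col x' y].
Proof.
move=> colC colP T3 col3.
pose P x := [:: a x; b x].
pose A s t := [set x | all (fun e => e \in [:: s; t]) (P x)]%SET.
have AP x s t : reflect {subset P x <= [:: s; t]} (x \in A s t).
  by rewrite finset.in_set; apply: allP.
(* Any [A s t] splits as required once it has two elements. *)
suff [s [t [x [y [yx xA yA]]]]] : exists s t x y,
    [/\ y != x, x \in A s t & y \in A s t].
  exists (A s t); split.
  - by apply/card_gt1P; exists x, y; rewrite eq_sym.
  - have [u [v [vu uv]]] := col3 s t.
    have out w w' : w' != w -> col w w' \notin [:: s; t] -> w \in ~: A s t.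
      move=> ww' cN; rewrite finset.in_setC; apply: contra cN => /AP; apply.
      exact: colP.
    apply/card_gt1P; exists u, v; split; rewrite 1?eq_sym //.
      exact: out uv.
    by apply: (out v u); rewrite 1?eq_sym 1?colC.
  - suff mono y' : y' \notin A s t ->
        exists e, forall z, z \in A s t -> col z y' = e.
      move=> z z' y' zA z'A /mono[e he]; by rewrite !he.
    move=> yN.
    have zP z : z \in A s t -> (col z y' \in [:: s; t]) && (col z y' \in P y').
      move=> zA; have zy : z != y' by apply: contraNneq yN => <-.
      rewrite {2}colC colP // andbT.
      by apply: (AP _ _ _ zA); apply: colP; rewrite eq_sym.
    (* One of the two colours of [y'] is not in {s, t}; the other one is the
       colour of all edges from [y'] to [A s t]. *)
    move: yN; rewrite finset.in_set /= andbT negb_and => /orP[] cN;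
      [exists (b y') | exists (a y')] => z /zP /andP[cz];
      rewrite in_cons mem_seq1 => /orP[] /eqP E //;
      by move: cN; rewrite -E cz.
apply: contrapT => nosplit.
have distinctP x y s t : y != x -> x \in A s t -> y \in A s t -> False.
  by move=> yx xA yA; apply: nosplit; exists s, t, x, y.
have PE x e : e \in P x -> exists f, P x =i [:: e; f].
  rewrite !inE => /orP[/eqP->|/eqP->]; first by exists (b x).
  by exists (a x) => z; rewrite !inE orbC.
have inA x s t : P x =i [:: s; t] -> x \in A s t.
  by move=> h; apply/AP => z; rewrite h.
(* Two of the edges from a vertex to three others have the same colour [e]. *)
have [x [y [z [e [yx zx zy exy exz]]]]] : exists x y z e,
    [/\ y != x, z != x, z != y, col x y = e & col x z = e].
  have /card_gt0P[x _] : (0 < #|T|)%N by lia.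
  have : (2 < #|[set~ x]%SET|)%N by have := cardsC1 x; lia.
  case/card_gt2P => [y1 [y2 [y3 [[]]]]]; rewrite !finset.in_setC1.
  move=> x1 x2 x3 [n12 n23 n31].
  have := colP x y3 x3; have := colP x y2 x2; have := colP x y1 x1.
  rewrite !in_cons !in_nil !orbF.
  have [e1 _|_ /= /eqP e1] := eqVneq (col x y1) (a x);
  have [e2 _|_ /= /eqP e2] := eqVneq (col x y2) (a x);
  have [e3 _|_ /= /eqP e3] := eqVneq (col x y3) (a x);
  first [ by exists x, y1, y2, (col x y1); split; rewrite ?e1 ?e2 // eq_sym
        | by exists x, y2, y3, (col x y2); split; rewrite ?e2 ?e3 // eq_sym
        | by exists x, y3, y1, (col x y3); split; rewrite ?e1 ?e3 // eq_sym ].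
have ex : e \in P x by rewrite -exy colP.
have ey : e \in P y by rewrite -exy colC colP // eq_sym.
have ez : e \in P z by rewrite -exz colC colP // eq_sym.
have [fx Ex] := PE x e ex; have [fy Ey] := PE y e ey; have [fz Ez] := PE z e ez.
have fxy : fx != fy.
  by apply/eqP => E; apply: (distinctP x y e fx); rewrite ?inA // E.
have fxz : fx != fz.
  by apply/eqP => E; apply: (distinctP x z e fx); rewrite ?inA // E.
have fyz : fy != fz.
  by apply/eqP => E; apply: (distinctP y z e fy); rewrite ?inA // E.
(* A vertex [w] without the colour [e] would see the three distinct colours
   [fx], [fy], [fz]. *)
have eP w : e \in P w.
  apply: contrapT => /negP eN.
  have fP u f : P u =i [:: e; f] -> e \in P u -> f \in P w.
    move=> Eu eu; have uw : u != w by apply: contraNneq eN => <-.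
    have cw : col w u \in P w by apply: colP.
    have := colP u w; rewrite eq_sym uw colC => /(_ isT).
    rewrite -/(P u) Eu in_cons mem_seq1 => /orP[] /eqP cE.
      by rewrite -cE cw in eN.
    by rewrite -cE.
  have : (size [:: fx; fy; fz] <= size (P w))%N.
    apply: uniq_leq_size.
      by rewrite /= !in_cons !in_nil !orbF negb_or fxy fxz fyz.
    by apply/allP; rewrite /= (fP x) // (fP y) // (fP z).
  by [].
(* An edge of another colour [f] gives both of its ends the pair {e, f}. *)
have [u [v [vu]]] := col3 e e.
rewrite in_cons mem_seq1 orbb => ce.
have [f Ef] := PE u e (eP u); have [g Eg] := PE v e (eP v).
have := colP u v vu; rewrite -/(P u) Ef in_cons (negPf ce) mem_seq1.
move=> /= /eqP cf.
have := colP v u; rewrite eq_sym vu colC -/(P v) Eg in_cons (negPf ce) mem_seq1.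
move=> /(_ isT) /= /eqP cg.
by apply: (distinctP u v e f vu); rewrite inA // -cf cg.
Qed.

(** * Large families have exactly two distances *)

Lemma ldmx_large_gt3 (R : realFieldType) n d (F : 'M[R]_(n, d)) :
  locally_two_distance_mx F -> ((d * (d + 1)) %/ 2 + 3 <= n)%N -> (3 < n)%N.
Proof.
move=> hF n_ge.
(* In dimension 0 the hypothesis n >= 3 contradicts the absolute bound. *)
have [d0|d_gt0] := posnP d; last by nia.
have := ldmx_bound hF.
have : (\rank (homog F) <= 1)%N.
  by apply: leq_trans (rank_leq_col _) _; rewrite d0.
case: (\rank _) => [|[|]] // _; rewrite /binomial /=; lia.
Qed.

Lemma ldmx_le_two_distances (R : realFieldType) n d (F : 'M[R]_(n, d)) :
  locally_two_distance_mx F -> ((d * (d + 1)) %/ 2 + 3 <= n)%N ->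
  exists s t, forall i j, j != i -> sqdist F i j \in [:: s; t].
Proof.
move=> hF n_ge.
have nosplit (A : {set 'I_n}) : (1 < #|A|)%N -> (1 < #|~: A|)%N ->
    ~ (forall x x' y, x \in A -> x' \in A -> y \notin A ->
        sqdist F x y = sqdist F x' y).
  by move=> A1 A1' eqA; have := split_bound hF A1 A1' eqA; lia.
have n4 := ldmx_large_gt3 hF n_ge.
apply: contrapT => nost.
have [al [be [_ _ hd]]] := hF.
have [|||s t|A [A1 A1' eqA]] := @exists_split 'I_n R (sqdist F) al be.
- by move=> x y; apply: eq_bigr => k _; rewrite -sqrrN opprB.
- move=> x y yx; rewrite !in_cons in_nil orbF; apply/orP.
  by case: (hd x y yx) => ->; [left|right].
- by rewrite card_ord.
- apply: contrapT => H; apply: nost; exists s, t => i j ji.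
  by apply: contrapT => /negP N; apply: H; exists i, j.
- exact: nosplit A A1 A1' eqA.
Qed.

(** If one value occurred alone, any two points would be a part [A] with which
    [split_bound] applies. *)
Lemma ldmx_two_distance (R : realFieldType) n d (F : 'M[R]_(n, d)) :
  locally_two_distance_mx F -> ((d * (d + 1)) %/ 2 + 3 <= n)%N ->
  exists s t, [/\ forall i j, j != i -> sqdist F i j \in [:: s; t],
    exists i j, j != i /\ sqdist F i j = s,
    exists i j, j != i /\ sqdist F i j = t & s != t].
Proof.
move=> hF n_ge; have n4 := ldmx_large_gt3 hF n_ge.
have [s [t hst]] := ldmx_le_two_distances hF n_ge.
have not_const e : ~ forall i j, j != i -> sqdist F i j = e.
  move=> const.
  pose i0 : 'I_n := Ordinal (ltnW (ltnW (ltnW n4))).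
  pose i1 : 'I_n := Ordinal (ltnW (ltnW n4)).
  pose A : {set 'I_n} := [set i0; i1]%SET.
  have cA : #|A| = 2%N by rewrite cards2.
  have cA' : (#|A| + #|~: A| = n)%N by rewrite cardsC card_ord.
  have A1' : (1 < #|~: A|)%N by lia.
  suff : (n <= (d * (d + 1)) %/ 2 + 2)%N by lia.
  apply: (@split_bound _ _ _ F A hF _ A1'); first by rewrite cA.
  move=> x x' y xA x'A yA; rewrite !const //.
    by apply: contraNneq yA => ->.
  by apply: contraNneq yA => ->.
exists s, t; split=> //.
- apply: contrapT => no; apply: (not_const t) => i j ji.
  have := hst i j ji; rewrite !in_cons in_nil orbF => /orP[] /eqP // E.
  by case: no; exists i, j.
- apply: contrapT => no; apply: (not_const s) => i j ji.
  have := hst i j ji; rewrite !in_cons in_nil orbF => /orP[] /eqP // E.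
  by case: no; exists i, j.
- apply/eqP => E; apply: (not_const s) => i j ji.
  by have := hst i j ji; rewrite -E !in_cons in_nil orbF orbb => /eqP.
Qed.

End PointMatrices.

(** * From sets of points to matrices *)

Section PointSets.
Local Open Scope ring_scope.

Lemma card_ge_family (R : realType) d n (X : set 'rV[R]_d) : `I_n #<= X ->
  exists f : 'I_n -> 'rV[R]_d, injective f /\ forall i, X (f i).
Proof.
move=> /pcard_surjP[g g_surj].
have /choice[f fP] : forall i : 'I_n, exists x, X x /\ g x = i.
  by move=> i; have [x Xx gx] := g_surj i (ltn_ord i); exists x.
exists f; split=> [i j fij|i]; last by case: (fP i).
by apply: val_inj; rewrite /= -(fP i).2 -(fP j).2 fij.
Qed.

Lemma card_eq_family (R : realType) d n (X : set 'rV[R]_d) : X #= `I_n ->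
  exists f : 'I_n -> 'rV[R]_d, injective f /\ X = range f.
Proof.
move=> /card_set_bijP[g [g_fun g_inj g_surj]].
have /choice[f fP] : forall i : 'I_n, exists x, X x /\ g x = i.
  by move=> i; have [x Xx gx] := g_surj i (ltn_ord i); exists x.
exists f; split=> [i j fij|].
  by apply: val_inj; rewrite /= -(fP i).2 -(fP j).2 fij.
apply/seteqP; split=> [x Xx|_ [i _ <-]]; last by case: (fP i).
exists (Ordinal (g_fun x Xx)) => //.
by apply: g_inj; rewrite ?inE //; case: (fP (Ordinal (g_fun x Xx))).
Qed.

Lemma card_le2_sub (R : realType) (S : set R) :
  S #<= `I_2 -> exists a b, S `<=` [set a; b].
Proof.
move=> /pcard_leP[g].
have g_inj : {in S &, injective g} by apply: inj.
have g_lt2 r : S r -> (g r < 2)%N by move=> Sr; exact: ('funS_g Sr).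
have pre k : exists r, forall x, S x -> g x = k -> x = r.
  have [[r [Sr gr]]|no] := pselect (exists r, S r /\ g r = k).
    by exists r => x Sx gx; apply: g_inj; rewrite ?inE // gx.
  by exists 0 => x Sx gx; case: no; exists x.
have [a Pa] := pre 0%N; have [b Pb] := pre 1%N.
exists a, b => r Sr; have : (g r < 2)%N by apply: g_lt2.
case E : (g r) => [|[|]] // _; [left; exact: Pa | right; exact: Pb].
Qed.

Lemma card_set2 (R : realType) (a b : R) : a != b -> [set a; b] #= `I_2.
Proof.
move=> ab; apply/card_set_bijP; exists (fun r => (r == b) : nat); split.
- by move=> r [->|->] /=; case: eqP.
- move=> r s; rewrite !inE => -[->|->] [->|->] //; rewrite eqxx (negPf ab) //.
- move=> [|[|k]] //= _; first by exists a; rewrite ?(negPf ab) //; left.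
  by exists b; rewrite ?eqxx //; right.
Qed.

Definition family_mx (R : realType) d n (f : 'I_n -> 'rV[R]_d) : 'M[R]_(n, d) :=
  \matrix_(i, k) f i 0 k.

Lemma edistE (R : realType) d n (f : 'I_n -> 'rV[R]_d) i j :
  edist (f i) (f j) = Num.sqrt (sqdist (family_mx f) i j).
Proof. by congr Num.sqrt; apply: eq_bigr => k _; rewrite !mxE. Qed.

Lemma sqdist_ge0 (R : realType) d n (F : 'M[R]_(n, d)) i j : 0 <= sqdist F i j.
Proof. by apply: sumr_ge0 => k _; exact: sqr_ge0. Qed.

Lemma sqdistE (R : realType) d n (f : 'I_n -> 'rV[R]_d) i j :
  sqdist (family_mx f) i j = edist (f i) (f j) ^+ 2.
Proof. by rewrite edistE sqr_sqrtr ?sqdist_ge0. Qed.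

Lemma sqdist_gt0 (R : realType) d n (f : 'I_n -> 'rV[R]_d) i j :
  injective f -> j != i -> 0 < sqdist (family_mx f) i j.
Proof.
move=> f_inj ji; rewrite lt_neqAle sqdist_ge0 andbT eq_sym.
apply: contraNneq ji => /psumr_eq0P H; apply/eqP/f_inj/rowP => k.
have /eqP := H (fun k _ => sqr_ge0 _) k isT.
by rewrite sqrf_eq0 subr_eq0 !mxE => /eqP.
Qed.

Lemma family_ldmx (R : realType) d (X : set 'rV[R]_d) n (f : 'I_n -> 'rV[R]_d) :
  locally_two_distance_set X -> injective f -> (forall i, X (f i)) ->
  locally_two_distance_mx (family_mx f).
Proof.
move=> ldX f_inj fX.
have ab i : exists p : R * R, [/\ 0 < p.1, 0 < p.2 & forall j, j != i ->
    sqdist (family_mx f) i j = p.1 \/ sqdist (family_mx f) i j = p.2].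
  have [a [b abP]] := card_le2_sub (ldX _ (fX i)).
  (* Of [a] and [b], those that are not distances from [f i] may vanish. *)
  pose pos (r : R) := if 0 < r ^+ 2 then r ^+ 2 else 1.
  have pos_gt0 r : 0 < pos r by rewrite /pos; case: ifP.
  exists (pos a, pos b); split=> //= j ji.
  have := sqdist_gt0 f_inj ji; rewrite sqdistE => e0.
  have [|/= E|/= E] := abP (edist (f i) (f j)).
  - by exists (f j); split=> // /f_inj E; rewrite E eqxx in ji.
  - by left; rewrite -E /pos e0.
  - by right; rewrite -E /pos e0.
have [p pP] := choice ab.
exists (fun i => (p i).1), (fun i => (p i).2).
by split=> [i|i|i j]; have [? ? h] := pP i => //; apply: h.
Qed.

Lemma card_ldset_le (R : realType) d (X : set 'rV[R]_d) n :
  locally_two_distance_set X -> `I_n #<= X -> (n <= 'C(d + 2, 2))%N.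
Proof.
move=> ldX /card_ge_family[f [f_inj fX]].
apply: leq_trans (ldmx_bound (family_ldmx ldX f_inj fX)) _.
apply: leq_bin2l; rewrite addn2 ltnS.
by apply: leq_trans (rank_leq_col _) _; rewrite addn1.
Qed.

Lemma ldset_card_eq (R : realType) d (X : set 'rV[R]_d) :
  locally_two_distance_set X -> exists2 n, X #= `I_n & (n <= 'C(d + 2, 2))%N.
Proof.
move=> ldX; have [/finite_setP[n Xn]|/infiniteP natX] := pselect (finite_set X).
  exists n => //; apply: (card_ldset_le ldX).
  by move: Xn; rewrite card_eq_le => /andP[].
suff : (('C(d + 2, 2)).+1 <= 'C(d + 2, 2))%N by rewrite ltnn.
by apply: (card_ldset_le ldX); apply: card_le_trans natX; apply: subset_card_le.
Qed.

Lemma exists_LDS2 (R : realType) d :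
  exists N, is_LDS2 R d N /\ (N <= 'C(d + 2, 2))%N.
Proof.
pose P n := `[< exists X : set 'rV[R]_d,
  locally_two_distance_set X /\ X #= `I_n >].
have P0 : exists n, P n.
  exists 0%N; apply/asboolP; exists set0; split; last by rewrite II0 card_eq00.
  by move=> x [].
have Pmax n : P n -> (n <= 'C(d + 2, 2))%N.
  move=> /asboolP[X [ldX Xn]]; apply: (card_ldset_le ldX).
  by move: Xn; rewrite card_eq_le => /andP[].
have [N /asboolP PN Nmax] := ex_maxnP P0 Pmax.
exists N; split; last by apply: Pmax; apply/asboolP.
split=> // X ldX; have [n Xn _] := ldset_card_eq ldX.
rewrite (card_le_eql Xn) card_le_II; apply: Nmax.
by apply/asboolP; exists X.
Qed.

Lemma ldset_two_distance (R : realType) d (X : set 'rV[R]_d) :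
  locally_two_distance_set X ->
  `I_((d * (d + 1)) %/ 2 + 3) #<= X -> two_distance_set X.
Proof.
move=> ldX n_le; have [n Xn _] := ldset_card_eq ldX.
have {}n_le : ((d * (d + 1)) %/ 2 + 3 <= n)%N.
  by move: n_le; rewrite (card_le_eqr Xn) card_le_II.
have [f [f_inj XE]] := card_eq_family Xn.
have fX i : X (f i) by rewrite XE; exists i.
have [s [t [hst [i [j [ji sE]]] [k [l [lk tE]]] st]]] :=
  ldmx_two_distance (family_ldmx ldX f_inj fX) n_le.
rewrite /two_distance_set (_ : distances X = [set Num.sqrt s; Num.sqrt t]).
  apply: card_set2; rewrite -sE -tE eqr_sqrt ?sqdist_ge0 //.
  by rewrite sE tE.
have dE u v : v != u -> distances X (edist (f u) (f v)).
  move=> vu; exists (f u), (f v); split=> // /f_inj E.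
  by rewrite E eqxx in vu.
apply/seteqP; split=> [_ [x [y [+ + + ->]]]|_ [->|->]]; last 2 first.
- by rewrite -sE -edistE; apply: dE.
- by rewrite -tE -edistE; apply: dE.
rewrite XE => -[u _ <-] [v _ <-] uv; rewrite edistE.
have /hst : v != u by apply/eqP => E; apply: uv; rewrite E.
by rewrite !in_cons in_nil orbF => /orP[] /eqP ->; [left|right].
Qed.

End PointSets.

Theorem corollary4p9 (R : realType) (d : nat) :
  (forall X : set 'rV[R]_d, locally_two_distance_set X ->
     `I_((d * (d + 1)) %/ 2 + 3) #<= X -> two_distance_set X) /\
  (exists N : nat, is_LDS2 R d N /\ N <= 'C(d + 2, 2)).
Proof. by split; [exact: ldset_two_distance | exact: exists_LDS2]. Qed.
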